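(* Let $p\in(2,\infty)$, $r\ge0$, $\mathsf R=r\begin{pmatrix}0&1&0\\-1&0&0\\0&0&0\end{pmatrix}$, $\widetilde\Phi(x)=\frac1p|x|^p-\frac12|\mathsf Rx|^2$, and $$\mathsf T=v\cdot\nabla_x+\mathsf Rx\cdot\nabla_x-\mathsf Rv\cdot\nabla_v-\nabla_x\widetilde\Phi\cdot\nabla_v$$ on $\mathbb R^3_x\times\mathbb R^3_v$. For every $\lambda\in(1/2,1)$ and $0<\delta<\frac13-\frac1{p+2}$, there exist constants $N\ge1$ and $C_1,C_2>0$ such that, for all $x,v\in\mathbb R^3$, $$N\langle v\rangle^{-6}e^{(2\lambda-1)\widetilde\Phi+\lambda|v|^2}-\mathsf T(x\cdot v)\,e^{2(\lambda-\frac1{p+2}-\delta)(\widetilde\Phi+\frac12|v|^2)}\ \ge\ C_1(|x|^p+|v|^2)e^{2(\lambda-\frac1{p+2}-\delta)(\widetilde\Phi+\frac12|v|^2)}$$ and $$C_1(|x|^p+|v|^2)e^{2(\lambda-\frac1{p+2}-\delta)(\widetilde\Phi+\frac12|v|^2)}\ \ge\ C_1e^{2(\lambda-\frac1{p+2}-\delta)(\widetilde\Phi+\frac12|v|^2)}-C_2.$$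
   Context: $\langle\cdot\rangle=(1+|\cdot|^2)^{1/2}$. $\mathsf T(x\cdot v)$ is the operator $\mathsf T$ applied to the function $(x,v)\mapsto x\cdot v$. *)

(* Defs.v *)
From HB Require Import structures.
From mathcomp Require Import all_boot all_order all_algebra.
From mathcomp Require Import all_classical all_reals all_analysis.
Set Implicit Arguments.
Unset Strict Implicit.
Unset Printing Implicit Defensive.
Import Order.TTheory GRing.Theory Num.Theory.
Import numFieldNormedType.Exports.
Local Open Scope ring_scope.

Definition dot (R : realType) (x y : 'cV[R]_3) : R :=
  \sum_(i < 3) x i 0 * y i 0.

(* The library norm on matrices is the sup norm, hence this definition. *)
Definition enorm (R : realType) (x : 'cV[R]_3) : R := Num.sqrt (dot x x).

Definition japanese (R : realType) (x : 'cV[R]_3) : R :=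
  Num.sqrt (1 + enorm x ^+ 2).

(* ['D_v f x] is total; it is the genuine derivative whenever [f] is derivable
   at [x] in the direction [v]. *)
Definition grad (R : realType) (f : 'cV[R]_3 -> R) (x : 'cV[R]_3) : 'cV[R]_3 :=
  \col_(i < 3) 'D_(delta_mx i 0) f x.

Definition rotmx (R : realType) (r : R) : 'M[R]_3 :=
  r *: (delta_mx 0 1 - delta_mx 1 0).

Definition effpot (R : realType) (p r : R) (x : 'cV[R]_3) : R :=
  p^-1 * enorm x `^ p - 2^-1 * enorm (rotmx r *m x) ^+ 2.

Definition transport (R : realType) (p r : R)
    (f : 'cV[R]_3 -> 'cV[R]_3 -> R) (x v : 'cV[R]_3) : R :=
  let gx := grad (fun y => f y v) x in
  let gv := grad (fun w => f x w) v in
  dot v gx + dot (rotmx r *m x) gx - dot (rotmx r *m v) gv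
  - dot (grad (effpot p r) x) gv.

(* Main.v *)
(** Since the rotation is antisymmetric and the potential is a sum of a
    [p]-homogeneous and a quadratic term, [T(x.v) = |v + Rx|^2 - |x|^p].
    After division by [E], with [c = 1/(p+2) + delta], the first inequality asks
    that [N <v>^-6 exp((2c-1) Phi + c|v|^2)] dominate
    [C1 (|x|^p + |v|^2) + |v + Rx|^2 - |x|^p]. As [p > 2], the latter can only be
    positive where [|x|^p] is at most about [|v|^2], up to a small factor and a
    constant; there the exponent is at least about [(c - (1-2c)/p) |v|^2], whose
    coefficient is positive exactly because [delta > 0]. *)
Require Import Defs.
From HB Require Import structures.
From mathcomp Require Import all_boot all_order all_algebra.
From mathcomp Require Import all_classical all_reals all_analysis.
From mathcomp Require Import ring lra.
Import Order.TTheory GRing.Theory Num.Theory.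
Import numFieldNormedType.Exports.
Local Open Scope ring_scope.

(** * The Euclidean inner product on column vectors and the rotation matrix *)

Lemma dotE {R : realType} (x y : 'cV[R]_3) : dot x y = (x^T *m y) 0 0.
Proof. by rewrite mxE; apply: eq_bigr => i _; rewrite mxE. Qed.

Lemma dotC {R : realType} (x y : 'cV[R]_3) : dot x y = dot y x.
Proof. by apply: eq_bigr => i _; rewrite mulrC. Qed.

Lemma dotDl {R : realType} (x y z : 'cV[R]_3) :
  dot (x + y) z = dot x z + dot y z.
Proof. by rewrite !dotE linearD mulmxDl mxE. Qed.

Lemma dotZl {R : realType} (a : R) (x y : 'cV[R]_3) :
  dot (a *: x) y = a * dot x y.
Proof. by rewrite !dotE linearZ -scalemxAl mxE. Qed.

Lemma dotNl {R : realType} (x y : 'cV[R]_3) : dot (- x) y = - dot x y.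
Proof. by rewrite -scaleN1r dotZl mulN1r. Qed.

Lemma dot0r {R : realType} (x : 'cV[R]_3) : dot x 0 = 0.
Proof. by rewrite dotE mulmx0 mxE. Qed.

Lemma dot_delta {R : realType} (x : 'cV[R]_3) (i : 'I_3) :
  dot x (delta_mx i 0) = x i 0.
Proof. by rewrite dotE -colE !mxE. Qed.

Lemma dot_mulmx {R : realType} (A : 'M[R]_3) (x y : 'cV[R]_3) :
  dot (A *m x) y = dot x (A^T *m y).
Proof. by rewrite !dotE trmx_mul mulmxA. Qed.

Lemma dot_ge0 {R : realType} (x : 'cV[R]_3) : 0 <= dot x x.
Proof. by apply: sumr_ge0 => i _; rewrite -expr2 sqr_ge0. Qed.

Lemma dot_eq0 {R : realType} (x : 'cV[R]_3) : (dot x x == 0) = (x == 0).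
Proof.
apply/idP/eqP => [|->]; last by rewrite dot0r.
rewrite psumr_eq0 => [/allP h|i _]; last by rewrite -expr2 sqr_ge0.
apply/matrixP => i j; rewrite (ord1 j) mxE; apply/eqP.
by have := h i (mem_index_enum _); rewrite mulf_eq0 orbb.
Qed.

Lemma enorm_sqr {R : realType} (x : 'cV[R]_3) : enorm x ^+ 2 = dot x x.
Proof. by rewrite sqr_sqrtr // dot_ge0. Qed.

Lemma enorm_powR {R : realType} (p : R) (x : 'cV[R]_3) :
  enorm x `^ p = dot x x `^ (p / 2).
Proof. by rewrite /enorm -powR12_sqrt ?dot_ge0 // -powRrM mulrC. Qed.

Lemma tr_rotmx {R : realType} (r : R) : (rotmx r)^T = - rotmx r.
Proof. by rewrite /rotmx linearZ linearB /= !trmx_delta -scalerN opprB. Qed.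

Lemma dot_rotmx_le {R : realType} (r : R) (x : 'cV[R]_3) :
  dot (rotmx r *m x) (rotmx r *m x) <= r ^+ 2 * dot x x.
Proof.
rewrite -subr_ge0 /dot /rotmx !big_ord_recl !big_ord0 !mxE.
rewrite !big_ord_recl !big_ord0 !mxE /=.
set x0 := x ord0 0; set x1 := x _ 0; set x2 := x _ 0.
rewrite [X in 0 <= X](_ : _ = (r * x2) ^+ 2) ?sqr_ge0 //; ring.
Qed.

(** * Gradients, and the value of the transport operator on the inner product *)

Lemma derive_line {R : realType} (f : 'cV[R]_3 -> R) (x v : 'cV[R]_3) :
  'D_v f x = 'D_1 (fun h : R => f (x + h *: v)) 0.
Proof.
have E : (fun h : R => h^-1 *: ((f \o shift x) (h *: v) - f x)) =
    (fun h : R => h^-1 *: (((fun t : R => f (x + t *: v)) \o shift 0) (h *: 1)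
                           - f (x + 0 *: v))).
  by apply/funext => t /=; rewrite scale0r !addr0 [t *: 1]mulr1 (addrC x).
by rewrite /derive E.
Qed.

Lemma is_derive0_quadratic {R : realType} (a b c : R) :
  is_derive (0 : R) 1 (fun h : R => a + h * b + h ^+ 2 * c) b.
Proof.
have d := @is_derive_id R R (0:R) (1:R).
have ca := @is_derive_cst R R R a (0:R) (1:R).
have cb := @is_derive_cst R R R b (0:R) (1:R).
have cc := @is_derive_cst R R R c (0:R) (1:R).
apply: (is_derive_eq (is_deriveD (is_deriveD ca (is_deriveM d cb))
  (is_deriveM (is_deriveX 2 d) cc))).
rewrite /GRing.scale /=; ring.
Qed.

Lemma grad_dotl {R : realType} (x v : 'cV[R]_3) : grad (fun y => dot y v) x = v.
Proof.
apply/matrixP => i j; rewrite (ord1 j) mxE derive_line.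
have -> : (fun h : R => dot (x + h *: delta_mx i 0) v) =
    (fun h : R => dot x v + h * v i 0 + h ^+ 2 * 0).
  apply/funext => h; rewrite dotDl dotZl (dotC (delta_mx _ _)) dot_delta.
  by rewrite mulr0 addr0.
exact: (@derive_val _ _ _ _ _ _ _ (is_derive0_quadratic _ _ 0)).
Qed.

Lemma grad_dotr {R : realType} (x v : 'cV[R]_3) : grad (fun w => dot x w) v = x.
Proof.
by rewrite -[RHS](grad_dotl v x); congr grad; apply/funext => w; exact: dotC.
Qed.

(** Along a line both squared norms are quadratic polynomials in [h]. As [x != 0], the power [p / 2]
    is differentiated at a positive base. *)
Lemma derive_effpot {R : realType} (p r : R) (x e : 'cV[R]_3) :
  x != 0 -> p != 0 ->
  'D_e (effpot p r) x = dot x x `^ (p / 2 - 1) * dot x e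
    - dot (rotmx r *m x) (rotmx r *m e).
Proof.
move=> x0 p0; rewrite derive_line.
have sq (u w : 'cV[R]_3) h : dot (u + h *: w) (u + h *: w) =
    dot u u + h * (2 * dot u w) + h ^+ 2 * dot w w.
  by rewrite dotDl dotZl !(dotC _ (_ + _)) !dotDl !dotZl (dotC w u); ring.
rewrite /effpot.
under eq_fun do rewrite enorm_powR enorm_sqr mulmxDr -scalemxAr !sq.
have dsq (u w : 'cV[R]_3) : is_derive (0 : R) 1 (fun h : R =>
    dot u u + h * (2 * dot u w) + h ^+ 2 * dot w w) (2 * dot u w).
  exact: is_derive0_quadratic.
have dpow : is_derive (0 : R) 1 (fun h : R =>
    (dot x x + h * (2 * dot x e) + h ^+ 2 * dot e e) `^ (p / 2))
    ((p / 2 * dot x x `^ (p / 2 - 1)) * (2 * dot x e)).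
  apply: (is_derive1_comp (f := fun a : R => a `^ (p / 2))) => //.
  rewrite expr0n /= !mul0r !addr0; apply: is_derive1_powR.
  by rewrite lt0r dot_eq0 x0 dot_ge0.
have d2 := dsq (rotmx r *m x) (rotmx r *m e).
by rewrite derive_val /GRing.scale /=; field.
Qed.

(** Euler's identity: the degrees [p] and 2 of the two homogeneous terms cancel their prefactors. *)
Lemma dot_grad_effpot {R : realType} (p r : R) (x : 'cV[R]_3) : 0 < p ->
  dot (grad (effpot p r) x) x =
  enorm x `^ p - dot (rotmx r *m x) (rotmx r *m x).
Proof.
move=> p0; have [->|x0] := eqVneq x 0.
  (* The gradient at the origin, whatever its value, is paired with [0]. *)
  rewrite enorm_powR mulmx0 !dot0r powR0 ?subr0 //.
  by rewrite gt_eqF // divr_gt0.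
have -> : grad (effpot p r) x = dot x x `^ (p / 2 - 1) *: x
    - (rotmx r)^T *m (rotmx r *m x).
  apply/matrixP => i j; rewrite (ord1 j) mxE derive_effpot ?gt_eqF //.
  rewrite dot_delta (dotC (rotmx r *m x)) dot_mulmx dotC dot_delta.
  by rewrite [RHS]mxE [in RHS]mxE [in RHS]mxE.
rewrite dotDl dotZl dotNl [in LHS](dot_mulmx (rotmx r)^T) trmxK; congr (_ - _).
have dx0 : 0 < dot x x by rewrite lt0r dot_eq0 x0 dot_ge0.
rewrite enorm_powR -{2}(powRr1 (ltW dx0)) -powRD ?subrK //.
by rewrite (gt_eqF dx0) implybT.
Qed.

(** By antisymmetry the two rotation terms coincide; together they form the cross term of the
    square. *)
Lemma transport_dot {R : realType} (p r : R) (x v : 'cV[R]_3) : 0 < p ->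
  transport p r (fun y w => dot y w) x v =
  dot (v + rotmx r *m x) (v + rotmx r *m x) - enorm x `^ p.
Proof.
move=> p0; rewrite /transport /= grad_dotl grad_dotr dot_grad_effpot //.
rewrite (dot_mulmx _ v) tr_rotmx mulNmx (dotC v (- _)) dotNl.
rewrite !dotDl !(dotC _ (v + _)) !dotDl (dotC v (rotmx r *m x)); ring.
Qed.

(** * Inequalities that absorb the error terms *)

Lemma dot_add_le {R : realType} (e : R) (v w : 'cV[R]_3) : 0 < e ->
  dot (v + w) (v + w) <= (1 + e) * dot v v + (1 + e^-1) * dot w w.
Proof.
move=> e0; have := dot_ge0 (e *: v - w).
rewrite !dotDl !dotNl !dotZl !(dotC _ (_ + _)) !dotDl !dotNl !dotZl (dotC w v).
move=> h; rewrite -subr_ge0.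
rewrite [X in 0 <= X](_ : _ = e^-1 * (e * (e * dot v v - dot v w)
  - (e * dot v w - dot w w))); last by field; rewrite gt_eqF.
by rewrite mulr_ge0 ?invr_ge0 ?(ltW e0).
Qed.

Lemma sqr_le_powR {R : realType} (p e : R) : 2 < p -> 0 < e ->
  exists2 K, 0 <= K & forall s, 0 <= s -> s ^+ 2 <= e * s `^ p + K.
Proof.
move=> p2 e0; have q0 : 0 < p - 2 by rewrite subr_gt0.
pose s0 := e^-1 `^ (p - 2)^-1.
exists (s0 ^+ 2) => [|s s_ge0]; first exact: sqr_ge0.
have [s_le|s_gt] := leP s s0.
  apply: (@le_trans _ _ (s0 ^+ 2)).
    by rewrite lerXn2r // nnegrE powR_ge0.
  by rewrite lerDr mulr_ge0 ?powR_ge0 // ltW.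
have s_gt0 : 0 < s by apply: le_lt_trans s_gt; exact: powR_ge0.
have le_e : e^-1 <= s `^ (p - 2).
  have -> : e^-1 = s0 `^ (p - 2).
    by rewrite -powRrM mulVf ?gt_eqF // powRr1 // invr_ge0 ltW.
  by apply: (ge0_ler_powR (ltW q0)); rewrite ?nnegrE ?powR_ge0 // ltW.
apply: (@le_trans _ _ (e * s `^ p)); last by rewrite lerDl sqr_ge0.
have -> : s `^ p = s `^ (p - 2) * s ^+ 2.
  rewrite -powR_mulrn // -powRD ?subrK //.
  by rewrite (gt_eqF s_gt0) implybT.
by rewrite mulrA ler_peMl ?sqr_ge0 // -ler_pdivrMl // mulr1.
Qed.

(** This is the fourth power of [z <= expR z] at [z = eta / 4 * y]. Later, three powers offset
    [(1 + t) ^- 3] and the fourth dominates an affine function of [t]. *)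
Lemma expR_ge_pow4 {R : realType} (eta y : R) : 0 <= eta -> 0 <= y ->
  (eta / 4) ^+ 4 * y ^+ 4 <= expR (eta * y).
Proof.
move=> e0 y0; have -> : eta * y = 4%:R * (eta / 4 * y) by field.
rewrite expRM_natl -exprMn lerXn2r ?nnegrE ?expR_ge0 //.
  by rewrite mulr_ge0 // divr_ge0.
by apply: le_trans (expR_ge1Dx _); rewrite lerDr.
Qed.

(* Where the left-hand side is positive, [P] is at most about [t], so that
   [b < c] makes the exponent grow linearly in [t]. *)
Lemma affine_le_expR {R : realType} (b c K : R)
    (eps := (c - b) / (4 * (c + b))) :
  0 < b -> b < c -> 0 <= K ->
  exists2 N, 1 <= N & forall t P, 0 <= t -> 0 <= P ->
    (1 + 2 * eps) * t - (1 - 2 * eps) * P + K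
      <= N * (1 + t) ^- 3 * expR (c * t - b * P).
Proof.
move=> b0 bc K0; pose eta := (c - b) / 2; pose M := 2 + K.
have cb0 : 0 < c + b by lra.
(* This makes the slope [(1 - 2 * eps) * c - (1 + 2 * eps) * b] exactly [eta]. *)
have epsE : eps * (c + b) = (c - b) / 4 by rewrite /eps; field; rewrite gt_eqF.
have eps0 : 0 < eps by rewrite divr_gt0 ?mulr_gt0 // subr_gt0.
have eps4 : eps <= 4^-1 by rewrite ler_pdivrMr; nra.
have eta0 : 0 < eta by rewrite divr_gt0 // subr_gt0.
(* [M * (1 + t)] bounds the left-hand side, the exponential pays for the shift in [expo], and the
   last factor inverts the constant of [expR_ge_pow4]. *)
pose N := M * expR (eta + 2 * b * K) * (4 / eta) ^+ 4.
exists (Num.max 1 N) => [|t P t0 P0]; first by rewrite le_max lexx.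
have [neg|pos] := leP ((1 + 2 * eps) * t - (1 - 2 * eps) * P + K) 0.
  apply: le_trans neg _; apply: mulr_ge0; last exact: expR_ge0.
  by apply: mulr_ge0; rewrite ?le_max ?ler01 // invr_ge0 exprn_ge0 // addr_ge0.
have expo : eta * (1 + t) - (eta + 2 * b * K) <= c * t - b * P.
  (* Positivity bounds [(1 - 2 * eps) * P] by [(1 + 2 * eps) * t + K]. Dividing by
     [1 - 2 * eps >= 1 / 2] then at most doubles [b * K]. *)
  have h : eta * t - b * K <= (1 - 2 * eps) * (c * t - b * P).
    by rewrite /eta; nra.
  have bK : 0 <= b * K by rewrite mulr_ge0 // ltW.
  have et : 0 <= eta * t by rewrite mulr_ge0 // ltW.
  by nra.
have t1 : 0 < 1 + t by lra.
have lhs : (1 + 2 * eps) * t - (1 - 2 * eps) * P + K <= M * (1 + t).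
  by rewrite /M; nra.
apply: le_trans lhs _.
apply: (@le_trans _ _ (N * (1 + t) ^- 3 * expR (c * t - b * P))); last first.
  rewrite ler_wpM2r ?expR_ge0 // ler_wpM2r ?invr_ge0 ?exprn_ge0 ?(ltW t1) //.
  by rewrite le_max lexx orbT.
rewrite mulrAC ler_pdivlMr ?exprn_gt0 // -mulrA -exprS.
have M0 : 0 < M by rewrite /M; lra.
rewrite /N -!(mulrA M) ler_pM2l //.
apply: (@le_trans _ _ ((4 / eta) ^+ 4 * ((eta / 4) ^+ 4 * (1 + t) ^+ 4))).
  have inv : 4 / eta * (eta / 4) = 1 by field; rewrite gt_eqF.
  by rewrite mulrA -exprMn inv expr1n mul1r.
rewrite [leRHS]mulrAC -expRD [leRHS]mulrC ler_pM2l; last first.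
  exact/exprn_gt0/divr_gt0.
apply: le_trans (expR_ge_pow4 _ _ (ltW eta0) (ltW t1)) _; rewrite ler_expR; lra.
Qed.

Theorem lemma4p5 (R : realType) (p r : R) (hp : 2 < p) (hr : 0 <= r)
    (lambda delta : R) (hlambda1 : 2^-1 < lambda) (hlambda2 : lambda < 1)
    (hdelta1 : 0 < delta) (hdelta2 : delta < 3^-1 - (p + 2)^-1) :
  exists N C1 C2 : R, [/\ 1 <= N, 0 < C1, 0 < C2 &
    forall x v : 'cV[R]_3,
      let E := expR (2 * (lambda - (p + 2)^-1 - delta)
                     * (effpot p r x + 2^-1 * enorm v ^+ 2)) in
      N * japanese v ^- 6
        * expR ((2 * lambda - 1) * effpot p r x + lambda * enorm v ^+ 2)
      - transport p r (fun y w => dot y w) x v * E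
        >= C1 * (enorm x `^ p + enorm v ^+ 2) * E
      /\ C1 * (enorm x `^ p + enorm v ^+ 2) * E >= C1 * E - C2].
Proof.
have p0 : 0 < p by lra.
have p20 : 0 < p + 2 by lra.
(* Dividing by [E] leaves the exponent [(2 * c - 1) * effpot p r x + c * t], free of [lambda]. Since
   [2 * c < 1] and [effpot p r x <= P / p], it is at least [c * t - b * P]. *)
pose c := (p + 2)^-1 + delta; pose b := (1 - 2 * c) / p.
have pinv0 : 0 < (p + 2)^-1 by rewrite invr_gt0.
have c3 : c < 3^-1 by rewrite /c; lra.
have b0 : 0 < b by rewrite divr_gt0 //; lra.
have bc : b < c.
  rewrite ltr_pdivrMr //.
  have : c * (p + 2) = 1 + delta * (p + 2) by rewrite /c mulrDl mulVf // gt_eqF.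
  by have := mulr_gt0 hdelta1 p20; lra.
pose eps := (c - b) / (4 * (c + b)).
have eps0 : 0 < eps by rewrite divr_gt0; lra.
(* The summand 1 keeps [kappa] positive when [r = 0], so that [eps / kappa] is a legitimate
   weight. *)
pose kappa := (1 + eps^-1) * r ^+ 2 + 1.
have epsV0 : 0 < eps^-1 by rewrite invr_gt0.
have kappa0 : 0 < kappa by rewrite ltr_wpDl // mulr_ge0 ?sqr_ge0 //; lra.
have [K K0 young] := sqr_le_powR _ _ hp (divr_gt0 eps0 kappa0).
have kK0 : 0 <= kappa * K by rewrite mulr_ge0 // ltW.
have [N N1 absorb] := affine_le_expR _ _ _ b0 bc kK0.
(* Where [P + t < 1], the energy is at most 3/2 and its coefficient in [E] at most 2, whence
   [expR 3]. *)
exists N, eps, (eps * expR 3); split => //; first by rewrite mulr_gt0 ?expR_gt0.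
move=> x v E.
set t := enorm v ^+ 2; set P := enorm x `^ p.
have t0 : 0 <= t by exact: sqr_ge0.
have P0 : 0 <= P by exact: powR_ge0.
have E0 : 0 <= E by exact: expR_ge0.
have m0 := dot_ge0 (rotmx r *m x).
have Phi_le : effpot p r x <= P / p.
  by rewrite /effpot enorm_sqr -/P; lra.
split.
  have rot_le : (1 + eps^-1) * dot (rotmx r *m x) (rotmx r *m x)
      <= eps * P + kappa * K.
    apply: (@le_trans _ _ (kappa * enorm x ^+ 2)).
      have /(ler_wpM2l (ltW (ltr_wpDl ler01 epsV0))) := dot_rotmx_le r x.
      move=> /le_trans; apply.
      by rewrite mulrA enorm_sqr ler_wpM2r ?dot_ge0 // lerDl.
    have /(ler_wpM2l (ltW kappa0)) := young _ (sqrtr_ge0 (dot x x)).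
    have -> : kappa * (eps / kappa * P + K) = eps * P + kappa * K.
      by field; rewrite gt_eqF.
    by [].
  have := dot_add_le eps v (rotmx r *m x) eps0.
  rewrite -(enorm_sqr v) -/t => add_le.
  have := absorb _ _ t0 P0; rewrite -/eps => main.
  rewrite transport_dot // -/P -/t -lerBlDr -mulNr -mulrBl.
  have -> : japanese v ^- 6 = (1 + t) ^- 3.
    by rewrite (exprM _ 2 3) sqr_sqrtr // addr_ge0.
  have -> : (2 * lambda - 1) * effpot p r x + lambda * t =
      ((2 * c - 1) * effpot p r x + c * t)
      + 2 * (lambda - (p + 2)^-1 - delta) * (effpot p r x + 2^-1 * t).
    by rewrite /c; field; rewrite gt_eqF.
  rewrite expRD -/E mulrA; apply: ler_wpM2r => //.
  (* Each [2 * eps] in [main] is spent twice: once on [C1 = eps], and once on [add_le] for [t] or on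
     [rot_le] for [P]. *)
  apply: (@le_trans _ _ (N * (1 + t) ^- 3 * expR (c * t - b * P))); first lra.
  have N0 : 0 <= N by lra.
  apply: ler_wpM2l; first by rewrite mulr_ge0 // invr_ge0 exprn_ge0 // addr_ge0.
  rewrite ler_expR; have : b * P = (1 - 2 * c) * (P / p) by rewrite /b; ring.
  have : (1 - 2 * c) * effpot p r x <= (1 - 2 * c) * (P / p).
    by apply: ler_wpM2l => //; lra.
  lra.
rewrite -mulrA -mulrBr ler_pM2l //.
(* Either the weight [P + t] already dominates 1, or [E] is bounded by [expR 3]. *)
have [big|small] := leP 1 (P + t).
  by apply: (@le_trans _ _ E); rewrite ?gerBl ?expR_ge0 ?ler_peMl.
apply: (@le_trans _ _ 0); last by rewrite mulr_ge0 // addr_ge0.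
rewrite subr_le0 /E ler_expR -/t.
have Pp : P / p <= 1 by rewrite ler_pdivrMr //; lra.
have a0 : 0 <= lambda - (p + 2)^-1 - delta by lra.
have : effpot p r x + 2^-1 * t <= 3 / 2 by lra.
move=> /(ler_wpM2l a0); lra.
Qed.
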